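(* Let $\mathcal{H}$ be a complex separable infinite-dimensional Hilbert space, let $A$ be a non-zero positive bounded operator on $\mathcal{H}$, and let $T\in\mathcal{B}_A(\mathcal{H})$. Then $T$ being $A$-normal is equivalent to each one of the following conditions: (i) $\widetilde{T}$ is a normal operator on the Hilbert space $\mathbf{R}(A^{1/2})$; (ii) $T^{\sharp_A}$ is $A$-normal; (iii) $\|Tx\|_A=\|T^{\sharp_A}x\|_A$ for all $x\in\mathcal{H}$.
   Context: $\mathcal{B}(\mathcal{H})$ is the algebra of bounded linear operators on $\mathcal{H}$; $A\in\mathcal{B}(\mathcal{H})$ is positive if $\langle Ax,x\rangle\ge 0$ for all $x$. $R(\cdot)$ denotes range. Put $\langle x,y\rangle_A=\langle Ax,y\rangle$ and $\|x\|_A=\langle x,x\rangle_A^{1/2}$. $\mathcal{B}_A(\mathcal{H})=\{T\in\mathcal{B}(\mathcal{H}): R(T^*A)\subseteq R(A)\}$. For $T\in\mathcal{B}_A(\mathcal{H})$, $T^{\sharp_A}$ is the unique $X\in\mathcal{B}(\mathcal{H})$ with $AX=T^*A$ and $R(X)\subseteq\overline{R(A)}$; one has $T^{\sharp_A}\in\mathcal{B}_A(\mathcal{H})$. $T\in\mathcal{B}_A(\mathcal{H})$ is called $A$-normal if $AT^{\sharp_A}T=ATT^{\sharp_A}$. $\mathcal{B}_{A^{1/2}}(\mathcal{H})=\{T\in\mathcal{B}(\mathcal{H}): \exists c>0,\ \|Tx\|_A\le c\|x\|_A\ \forall x\in\mathcal{H}\}$ (it contains $\mathcal{B}_A(\mathcal{H})$).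 $\mathbf{R}(A^{1/2})$ is the Hilbert space $R(A^{1/2})$ with inner product $(A^{1/2}x,A^{1/2}y)=\langle Px,Py\rangle$, where $P$ is the orthogonal projection of $\mathcal{H}$ onto $\overline{R(A)}$; $R(A)$ is dense in it and $(Ax,Ay)=\langle x,y\rangle_A$. For $T\in\mathcal{B}_{A^{1/2}}(\mathcal{H})$, $\widetilde{T}$ is the unique bounded operator on $\mathbf{R}(A^{1/2})$ with $\widetilde{T}Ax=ATx$ for all $x\in\mathcal{H}$. *)

(* Defs.v *)
From HB Require Import structures.
From mathcomp Require Import all_boot all_order all_algebra sesquilinear.
From mathcomp Require Import complex.
From mathcomp Require Import boolp classical_sets cardinality functions reals.
From mathcomp Require Import topology normedtype.

Set Implicit Arguments.
Unset Strict Implicit.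
Unset Printing Implicit Defensive.

Import Order.TTheory GRing.Theory Num.Theory.
Import numFieldNormedType.Exports.

Local Open Scope classical_set_scope.
Local Open Scope ring_scope.

(* [{dot H for Num.conj}] is linear in its first argument and conjugate-linear
   in the second one. *)
HB.mixin Record CompleteNormedModule_isHilbert (R : realType) (H : Type)
    of CompleteNormedModule R[i] H := {
  inner : {dot H for (Num.conj : R[i] -> R[i])} ;
  inner_normE : forall x : H, `|x| ^+ 2 = inner x x }.

#[short(type="hilbertType")]
HB.structure Definition Hilbert (R : realType) :=
  { H of CompleteNormedModule R[i] H & CompleteNormedModule_isHilbert R H }.

Section SpaceConditions.
Variables (R : realType).

Definition separable (H : topologicalType) : Prop :=
  exists D : set H, countable D /\ dense D.

Definition infinite_dimensional (V : lmodType R[i]) : Prop :=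
  forall (n : nat) (e : 'I_n -> V),
    ~ (forall x : V, exists c : 'I_n -> R[i], x = \sum_(i < n) c i *: e i).

End SpaceConditions.

(* These notions take the inner product [ip] as an explicit argument because
   they are used both on H, with [inner], and on R(A^(1/2)), whose inner product
   is not the one it inherits from H.

   Here and below [xget] picks an object that is known to exist and to be unique
   under the relevant hypotheses; the default value 0 is then irrelevant. *)
Section Operators.
Variables (R : realType) (V : lmodType R[i]) (ip : V -> V -> R[i]).

Definition ipnorm (x : V) : R[i] := sqrtC (ip x x).

Definition bounded_op : set (V -> V) :=
  [set T | linear T /\
     exists c : R[i], 0 < c /\ forall x, ipnorm (T x) <= c * ipnorm x].

Definition adjoint (T : V -> V) : V -> V :=
  xget (fun=> 0) [set S | bounded_op S /\
                          forall x y, ip (T x) y = ip x (S y)].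

Definition normal_op (T : V -> V) : Prop :=
  bounded_op T /\ T \o adjoint T = adjoint T \o T.

End Operators.

Section SemiHilbert.
Variables (R : realType) (H : hilbertType R).

Local Notation B_H := (bounded_op (inner : H -> H -> R[i])).
Local Notation adj := (adjoint (inner : H -> H -> R[i])).

Definition positive_op (A : H -> H) : Prop :=
  B_H A /\ forall x, 0 <= inner (A x) x.

Definition semi_inner (A : H -> H) (x y : H) : R[i] := inner (A x) y.

Definition semi_norm (A : H -> H) (x : H) : R[i] := ipnorm (semi_inner A) x.

Definition B_A (A : H -> H) : set (H -> H) :=
  [set T | B_H T /\ range (adj T \o A) `<=` range A].

Definition sharp (A T : H -> H) : H -> H :=
  xget (fun=> 0) [set X | [/\ B_H X, A \o X = adj T \o A &
                              range X `<=` closure (range A)]].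

Definition semi_normal (A T : H -> H) : Prop :=
  B_A A T /\ A \o sharp A T \o T = A \o T \o sharp A T.

Definition sqrt_op (A : H -> H) : H -> H :=
  xget (fun=> 0) [set S | positive_op S /\ S \o S = A].

(* The orthogonal projection of H onto M, provided M is a closed subspace. *)
Definition proj (M : set H) (x : H) : H :=
  xget 0 [set y | M y /\ forall z, M z -> inner (x - y) z = 0].

Record range_sqrt (A : H -> H) := RangeSqrt {
  range_sqrt_val :> H ;
  range_sqrt_valP : range_sqrt_val \in range (sqrt_op A) }.

End SemiHilbert.

Section RangeSqrt.
Variables (R : realType) (H : hilbertType R) (A : H -> H).

HB.instance Definition _ := [isSub for @range_sqrt_val R H A].
HB.instance Definition _ := [Choice of range_sqrt A by <:].

Lemma sqrt_op_linear : linear (sqrt_op A).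
Proof.
rewrite /sqrt_op; case: xgetP => [S _ [[[lS _] _] _] //|_ a x y].
by rewrite scaler0 addr0.
Qed.

Lemma range_sqrt_op_closed :
  GRing.submod_closed [pred y : H | y \in range (sqrt_op A)].
Proof.
have lS := sqrt_op_linear; split=> [|a u v]; rewrite !inE.
  exists 0 => //; have := lS (-1) 0 0.
  by rewrite !scaleN1r !addNr.
by move=> [x _ <-] [y _ <-]; exists (a *: x + y); rewrite ?lS.
Qed.

HB.instance Definition _ :=
  GRing.SubChoice_isSubLmodule.Build R[i] H
    [pred y : H | y \in range (sqrt_op A)] (range_sqrt A) range_sqrt_op_closed.

(* (A^(1/2) x, A^(1/2) y) = <P x, P y>, where P is the projection onto the
   closure of R(A); P x does not depend on the choice of the preimage x. *)
Definition range_sqrt_inner (u v : range_sqrt A) : R[i] :=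
  let P := proj (closure (range A)) in
  let pre (w : range_sqrt A) := xget 0 [set x | sqrt_op A x = val w] in
  inner (P (pre u)) (P (pre v)).

Definition tilde (T : H -> H) : range_sqrt A -> range_sqrt A :=
  xget (fun=> 0) [set N | bounded_op range_sqrt_inner N /\
    forall (u : range_sqrt A) (x : H), val u = A x -> val (N u) = A (T x)].

End RangeSqrt.

(* Main.v *)
Require Import Defs.
From mathcomp Require Import all_boot all_order all_algebra complex sesquilinear.
From mathcomp Require Import boolp classical_sets reals topology normedtype.
From mathcomp Require Import ring lra.

Set Implicit Arguments.
Unset Strict Implicit.
Unset Printing Implicit Defensive.

Import Order.TTheory GRing.Theory Num.Theory.
Import numFieldNormedType.Exports.

Local Open Scope classical_set_scope.
Local Open Scope ring_scope.
Local Open Scope complex_scope.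

(* X = T^(sharp) is an adjoint of T for the semi-inner product <x, y>_A = <A x, y>,
   so A-normality says that the quadratic forms <X T x, x>_A = |T x|_A^2 and
   <T X x, x>_A = |X x|_A^2 agree, which is (iii) by polarisation.  From
   X^* A = A T one gets A X^(sharp) = A T, so both sides of (ii) are the same
   equation.  Finally X induces on R(A^(1/2)) the adjoint of the operator induced
   by T, and R(A) is dense in R(A^(1/2)), which gives (i).

   The objects themselves have to be shown to exist.  Adjoints, projections and
   the extension of densely defined operators all come from one Riesz lemma for
   functionals dominated by [|D x|] with D linear; T^(sharp) is bounded by a Baire
   argument; the square root is the limit of the iteration Y -> (B + Y^2) / 2; and
   boundedness of T for |.|_A follows from a power trick applied to X T. *)

(** * Linear maps given as bare functions *)

Section Linear.
Variables (R : realType) (U V : lmodType R[i]) (T : U -> V).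
Hypothesis lT : linear T.

Lemma linear_D : forall x y, T (x + y) = T x + T y.
Proof. by move=> x y; have := lT 1 x y; rewrite !scale1r. Qed.

Lemma linear_0 : T 0 = 0.
Proof. by have := lT (-1) 0 0; rewrite !scaleN1r !addNr. Qed.

Lemma linear_Z : forall a x, T (a *: x) = a *: T x.
Proof. by move=> a x; have := lT a x 0; rewrite linear_0 !addr0. Qed.

Lemma linear_B : forall x y, T (x - y) = T x - T y.
Proof. by move=> x y; rewrite linear_D -scaleN1r linear_Z scaleN1r. Qed.

End Linear.

(** * The real inner product *)

Section RealPart.
Variables (R : realType) (H : hilbertType R).
Implicit Types (x y z : H) (a : R[i]).

(** The norm and the inner product take values in [R[i]], whose order is partial; real-valued copies
    make [lra] and [nra] available. *)
Definition rnorm x : R := complex.Re `|x|.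
Definition rip x y : R := complex.Re (inner x y).

Lemma innerDl x y z : inner (x + y) z = inner x z + inner y z.
Proof. exact: linearDl. Qed.

Lemma innerZl a x z : inner (a *: x) z = a * inner x z.
Proof. exact: linearZl_LR. Qed.

Lemma innerC x y : inner x y = (inner y x)^*.
Proof.
have := @hermitian_subproof _ _ _ _ (inner : {dot H for Num.conj}) x y.
by rewrite expr0 mul1r.
Qed.

Lemma ripDl x y z : rip (x + y) z = rip x z + rip y z.
Proof. by rewrite /rip innerDl raddfD. Qed.

Lemma ripC x y : rip x y = rip y x.
Proof. by rewrite /rip innerC; case: (inner y x). Qed.

Lemma ripDr x y z : rip x (y + z) = rip x y + rip x z.
Proof. by rewrite !(ripC x) ripDl. Qed.

Lemma ripZl (t : R) x y : rip (t%:C *: x) y = t * rip x y.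
Proof. by rewrite /rip innerZl; case: (inner x y) => a b /=; rewrite mul0r subr0. Qed.

Lemma ripZr (t : R) x y : rip x (t%:C *: y) = t * rip x y.
Proof. by rewrite ripC ripZl ripC. Qed.

Lemma ripNl x y : rip (- x) y = - rip x y.
Proof. by rewrite -scaleN1r -[-1](_ : (-1 : R)%:C = _) ?ripZl ?mulN1r // rmorphN1. Qed.

Lemma ripNr x y : rip x (- y) = - rip x y.
Proof. by rewrite ripC ripNl ripC. Qed.

Lemma ripBl x y z : rip (x - y) z = rip x z - rip y z.
Proof. by rewrite ripDl ripNl. Qed.

Lemma ripBr x y z : rip x (y - z) = rip x y - rip x z.
Proof. by rewrite ripDr ripNr. Qed.

Lemma rip0l y : rip 0 y = 0.
Proof. by rewrite -[0](subrr (0 : H)) ripBl subrr. Qed.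

Lemma rip0r y : rip y 0 = 0.
Proof. by rewrite ripC rip0l. Qed.

Lemma ripil x y : rip ('i *: x) y = - complex.Im (inner x y).
Proof. by rewrite /rip innerZl; case: (inner x y) => a b /=;
  rewrite mul0r mul1r sub0r. Qed.

Lemma ripiC x y : rip ('i *: x) y = - rip x ('i *: y).
Proof. by rewrite (ripC x) !ripil (innerC x); case: (inner y x). Qed.

Lemma rip_ii x y : rip ('i *: x) ('i *: y) = rip x y.
Proof. by rewrite ripiC scalerA -expr2 sqr_i scaleN1r ripNr opprK. Qed.

(** Reduces identities between complex inner products to real ones, taken once at [x] and once at
    ['i *: x]. *)
Lemma innerE x y : inner x y = rip x y -i* rip ('i *: x) y.
Proof. by rewrite ripil opprK /rip; case: (inner x y). Qed.

Lemma rnormE x : `|x| = (rnorm x)%:C.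
Proof.
rewrite /rnorm; have: 0 <= `|x| by exact: normr_ge0.
by rewrite lecE => /andP[/eqP /= e _]; case: (`|x|) e => a b /= ->.
Qed.

Lemma rnorm_ge0 x : 0 <= rnorm x.
Proof. by have := normr_ge0 x; rewrite rnormE lecE => /andP[]. Qed.

Lemma inner_xx x : inner x x = (rip x x)%:C.
Proof.
rewrite innerE ripiC /=; congr (_ +i* _).
have /eqP := ripiC x x; rewrite ripC -addr_eq0 -mulr2n mulrn_eq0 /= => /eqP ->.
by rewrite !oppr0.
Qed.

Lemma rnorm_sqr x : rnorm x ^+ 2 = rip x x.
Proof. by have := inner_normE x; rewrite rnormE inner_xx -rmorphXn => /complexI. Qed.

Lemma rip_ge0 x : 0 <= rip x x.
Proof. by rewrite -rnorm_sqr sqr_ge0. Qed.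

Lemma rnorm0_eq0 x : rnorm x = 0 -> x = 0.
Proof. by move=> x0; apply/eqP; rewrite -normr_eq0 rnormE x0. Qed.

Lemma rip0_eq0 x : rip x x = 0 -> x = 0.
Proof. by rewrite -rnorm_sqr => /eqP; rewrite sqrf_eq0 => /eqP /rnorm0_eq0. Qed.

Lemma rnorm0 : rnorm 0 = 0.
Proof. by rewrite /rnorm normr0. Qed.

Lemma rnormN x : rnorm (- x) = rnorm x.
Proof. by rewrite /rnorm normrN. Qed.

Lemma rnorm_distC x y : rnorm (x - y) = rnorm (y - x).
Proof. by rewrite -rnormN opprB. Qed.

Lemma rnormD x y : rnorm (x + y) <= rnorm x + rnorm y.
Proof. by have := ler_normD x y; rewrite !rnormE -rmorphD lecR. Qed.

Lemma rnormB x y : rnorm (x - y) <= rnorm x + rnorm y.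
Proof. by rewrite -(rnormN y) rnormD. Qed.

Lemma rnorm_dist_tri z x y : rnorm (x - y) <= rnorm (x - z) + rnorm (z - y).
Proof. by rewrite (le_trans _ (rnormD _ _)) // addrA subrK. Qed.

Lemma rnormZ (t : R) x : rnorm (t%:C *: x) = `|t| * rnorm x.
Proof.
by have := normrZ t%:C x;
  rewrite !rnormE normc_def /= expr0n addr0 sqrtr_sqr -rmorphM => /complexI.
Qed.

Lemma parallelogram x y :
  rnorm (x - y) ^+ 2 = 2 * rnorm x ^+ 2 + 2 * rnorm y ^+ 2 - rnorm (x + y) ^+ 2.
Proof.
rewrite !rnorm_sqr !(ripDl, ripDr, ripNl, ripNr) (ripC y x); ring.
Qed.

End RealPart.

(** * Cauchy-Schwarz for positive semidefinite real forms *)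

Section CauchySchwarz.
Variables (R : realType) (V : lmodType R[i]) (b : V -> V -> R).
Hypotheses (bD : forall x y z, b (x + y) z = b x z + b y z)
  (bZ : forall (t : R) x y, b (t%:C *: x) y = t * b x y)
  (bC : forall x y, b x y = b y x) (b_ge0 : forall x, 0 <= b x x).

Lemma form_CS x y : b x y ^+ 2 <= b x x * b y y.
Proof.
have q s t : 0 <= s ^+ 2 * b x x + 2 * s * t * b x y + t ^+ 2 * b y y.
  have := b_ge0 (s%:C *: x + t%:C *: y).
  rewrite bD 2!(bC _ (_ + _)) !bD !bZ !(bC _ (_ *: _)) !bZ (bC y x) => h.
  by apply: le_trans h _; rewrite le_eqVlt; apply/orP; left; apply/eqP; ring.
have [y0|y0] := eqVneq (b y y) 0.
  rewrite y0 mulr0; have [->|xy] := eqVneq (b x y) 0; first by rewrite expr0n.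
  (* With [b y y = 0] the quadratic form is affine in [t]; this [t] gives it the value -1. *)
  have := q 1 (- (b x x + 1) / (2 * b x y)).
  have -> : 1 ^+ 2 * b x x + 2 * 1 * (- (b x x + 1) / (2 * b x y)) * b x y +
    (- (b x x + 1) / (2 * b x y)) ^+ 2 * b y y = -1 by rewrite y0; field.
  by lra.
have y1 : 0 < b y y by rewrite lt_def y0 b_ge0.
(* At this point the quadratic form is [b y y] times the desired difference. *)
have := q (b y y) (- b x y).
have -> : b y y ^+ 2 * b x x + 2 * b y y * - b x y * b x y +
  (- b x y) ^+ 2 * b y y = b y y * (b x x * b y y - b x y ^+ 2) by ring.
by rewrite pmulr_rge0 // subr_ge0.
Qed.

End CauchySchwarz.

Lemma rip_le (R : realType) (H : hilbertType R) (x y : H) :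
  rip x y <= rnorm x * rnorm y.
Proof.
have := form_CS (@ripDl R H) (@ripZl R H) (@ripC R H) (@rip_ge0 R H) x y.
rewrite -!rnorm_sqr -exprMn => h.
rewrite (le_trans (ler_norm _)) // -ler_sqr ?nnegrE ?mulr_ge0 ?rnorm_ge0 //.
by rewrite real_normK ?num_real.
Qed.

Lemma rip_abs_le (R : realType) (H : hilbertType R) (x y : H) :
  `|rip x y| <= rnorm x * rnorm y.
Proof.
rewrite ler_norml; apply/andP; split; last exact: rip_le.
by rewrite lerNl -ripNl -(rnormN x) rip_le.
Qed.

(** * Boundedness, closure and completeness in terms of the real norm *)

Section Topology.
Variables (R : realType) (H : hilbertType R).
Implicit Types (x y z : H) (D : set H).

(** General in [ip] because it serves both H and R(A^(1/2)). *)
Lemma bounded_op_realP (V : lmodType R[i]) (ip : V -> V -> R[i]) (n : V -> R)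
    (T : V -> V) :
  (forall v, 0 <= n v) -> (forall v, ip v v = (n v ^+ 2)%:C) ->
  bounded_op ip T <->
  linear T /\ exists c : R, 0 <= c /\ forall v, n (T v) <= c * n v.
Proof.
move=> n0 hn; have nE v : ipnorm ip v = (n v)%:C.
  by rewrite /ipnorm hn rmorphXn sqrCK // lecR.
split=> [[lT [c [c0 hc]]]|[lT [c [c0 hc]]]]; split=> //.
  exists (complex.Re c); move: c0; rewrite ltcE => /andP[/eqP /= ic /ltW ?].
  split=> // x; have := hc x; rewrite !nE lecE => /andP[_].
  by case: (c) ic => a b /= ->; rewrite mul0r subr0.
(* [bounded_op] asks for a strictly positive constant, while [c] may be 0. *)
exists (c + 1)%:C; split; first by rewrite ltcR ltr_wpDl.
move=> x; rewrite !nE -rmorphM lecR (le_trans (hc x)) // ler_wpM2r //.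
by rewrite lerDl.
Qed.

Lemma bounded_opP (T : H -> H) : bounded_op (inner : H -> H -> R[i]) T <->
  linear T /\ exists c : R, 0 <= c /\ forall x, rnorm (T x) <= c * rnorm x.
Proof.
apply: bounded_op_realP => x; first exact: rnorm_ge0.
by rewrite inner_xx rnorm_sqr.
Qed.

Lemma rnbhsP x (P : set H) :
  nbhs x P <-> exists e : R, 0 < e /\ forall y, rnorm (x - y) < e -> P y.
Proof.
split=> [/nbhs_normP[e /= e0 he]|[e [e0 he]]].
  exists (complex.Re e); move: e0; rewrite ltcE => /andP[/eqP /= ie e0].
  split=> // y xy; apply: he; rewrite /ball_ /= rnormE.
  by case: (e) ie xy => a b /= -> xy; rewrite ltcR.
apply/nbhs_normP; exists e%:C => /=; first by rewrite ltcR.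
by move=> y; rewrite /ball_ /= rnormE ltcR; exact: he.
Qed.

Lemma rclosureP D x :
  closure D x <-> forall e : R, 0 < e -> exists y, D y /\ rnorm (x - y) < e.
Proof.
split=> [cx e e0|h B /rnbhsP[e [e0 he]]].
  have [|y [Dy xy]] := cx [set y | rnorm (x - y) < e]; last by exists y.
  by apply/rnbhsP; exists e.
by have [y [Dy xy]] := h e e0; exists y; split=> //; exact: he.
Qed.

Lemma rcauchy_cvg (u : nat -> H) :
  (forall e : R, 0 < e -> exists N, forall n, (N <= n)%N -> rnorm (u N - u n) < e) ->
  exists l, forall e : R, 0 < e ->
    exists N, forall n, (N <= n)%N -> rnorm (l - u n) < e.
Proof.
move=> cu; have /cauchy_cvg/cvg_ex[l ul] : cauchy (u @ \oo).
  apply: cauchy_exP => e; rewrite ltcE => /andP[/eqP /= ie e0].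
  have [N hN] := cu _ e0; exists (u N); exists N => // n /= Nn.
  rewrite -ball_normE /ball_ /= rnormE.
  by case: (e) ie (hN _ Nn) => a b /= -> ?; rewrite ltcR.
exists l => e e0; have := ul [set y | rnorm (l - y) < e].
case=> [|N _ hN]; first by apply/rnbhsP; exists e.
by exists N.
Qed.

End Topology.

(** The form in which limits are taken below: an arbitrarily small error multiplied by a fixed
    factor, which may be 0. *)
Lemma le_eps_mul (R : realType) (a b k : R) :
  0 <= k -> (forall e : R, 0 < e -> a <= b + e * k) -> a <= b.
Proof.
move=> k0 h; apply/ler_addgt0Pr => e e0.
have k1 : 0 < k + 1 by rewrite ltr_wpDl.
rewrite (le_trans (h (e / (k + 1)) _)) ?divr_gt0 // lerD2l.
by rewrite -mulrA ger_pMr // mulrC ler_pdivrMr // mul1r lerDl.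
Qed.

Lemma ex_inv_lt (R : realType) (e : R) : 0 < e -> exists N, N.+1%:R^-1 < e.
Proof.
move=> e0; have [N hN] : exists N : nat, e^-1 < N%:R.
  by exists (Num.bound e^-1); rewrite archi_boundP // invr_ge0 ltW.
exists N; rewrite invf_plt ?posrE ?ltr0n // (lt_le_trans hN) // ler_nat //.
Qed.

Lemma inv_le_inv (R : realType) (m n : nat) :
  (m <= n)%N -> n.+1%:R^-1 <= m.+1%:R^-1 :> R.
Proof. by move=> mn; rewrite lef_pV2 ?posrE ?ltr0n // ler_nat ltnS. Qed.

(** * Riesz representation and adjoints *)

Section Riesz.
Variables (R : realType) (H : hilbertType R) (V : lmodType R[i]).
Variables (D : V -> H) (phi : V -> R[i]) (c : R).
Hypotheses (lD : linear D) (lphi : scalar phi) (c0 : 0 <= c)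
  (phi_le : forall x, complex.Re (phi x) <= c * rnorm (D x)).

Let f x := complex.Re (phi x).

Let phiD x y : phi (x + y) = phi x + phi y.
Proof. by have := lphi 1 x y; rewrite scale1r mul1r. Qed.

Let phi0 : phi 0 = 0.
Proof. by have := phiD 0 0; rewrite addr0 => /eqP;
  rewrite -subr_eq0 opprD addNKr oppr_eq0 => /eqP. Qed.

Let phiZ a x : phi (a *: x) = a * phi x.
Proof. by have := lphi a x 0; rewrite phi0 !addr0. Qed.

Let fD x y : f (x + y) = f x + f y.
Proof. by rewrite /f phiD raddfD. Qed.

Let fZ (t : R) x : f (t%:C *: x) = t * f x.
Proof. by rewrite /f phiZ; case: (phi x) => a b /=; rewrite mul0r subr0. Qed.

Let J x := rnorm (D x) ^+ 2 - 2 * f x.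

(* The representing vector is the limit of a minimising sequence of the energy
   [|D x|^2 - 2 Re (phi x)]. *)
Lemma riesz_range :
  exists y, [/\ closure (range D) y, forall x, phi x = inner (D x) y
              & rnorm y <= c].
Proof.
have Jlb : has_lbound (range J).
  (* The energy is at least [s^2 - 2 c s = (s - c)^2 - c^2] with [s = |D x|]. *)
  exists (- c ^+ 2) => _ [x _ <-]; rewrite /J; have := phi_le x; rewrite -/(f x).
  have := sqr_ge0 (rnorm (D x) - c); nra.
have Jinf : has_inf (range J) by split; [exists (J 0); exists 0|].
set d := inf (range J).
have dJ x : d <= J x by apply: ge_inf => //; exists x.
have /choice[x hx] : forall n : nat, exists x, J x < d + n.+1%:R^-1.
  move=> n; have [|_ [x _ <-] hx] := @inf_adherent _ (range J) n.+1%:R^-1 _ Jinf.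
    by rewrite invr_gt0 ltr0n.
  by exists x.
(* Parallelogram law, with the energy of the midpoint of [x m] and [x n] bounded below by [d]. *)
have dist m n : rnorm (D (x m) - D (x n)) ^+ 2 < 2 * m.+1%:R^-1 + 2 * n.+1%:R^-1.
  rewrite parallelogram -(linear_D lD).
  have := dJ (2^-1%:C *: (x m + x n)); rewrite /J fZ fD (linear_Z lD) rnormZ.
  rewrite ger0_norm ?invr_ge0 ?ler0n // exprMn.
  have := hx m; have := hx n; rewrite /J;
    move: (m.+1%:R^-1) (n.+1%:R^-1) => a b h1 h2 h3; lra.
have [e e0|l hl] := @rcauchy_cvg R H (fun n => D (x n)).
  have [|N hN] := @ex_inv_lt R (e ^+ 2 / 4); first by rewrite divr_gt0 ?exprn_gt0.
  exists N => n Nn; rewrite -ltr_sqr ?nnegrE ?rnorm_ge0 ?ltW //.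
  have := dist N n; have := inv_le_inv R Nn; move: hN;
    move: (N.+1%:R^-1) (n.+1%:R^-1) => a b; lra.
have cl : closure (range D) l.
  apply/rclosureP => e /hl[N hN]; exists (D (x N)); split; first by exists (x N).
  exact: hN.
have fE z : f z = rip (D z) l.
  set k := rnorm (D z) ^+ 2; set g := rip (D z) l - f z.
  have k0 : 0 <= k by exact: sqr_ge0.
  (* First variation: the energy is at least [d] at [x n + t z] and tends to [d] at [x n], so their
     difference has a nonnegative limit. *)
  have q t : 0 <= 2 * t * g + t ^+ 2 * k.
    apply: (@le_eps_mul _ _ _ (2 * `|t| * rnorm (D z) + 1)) => [|e e0].
      by rewrite addr_ge0 // !mulr_ge0 ?rnorm_ge0.
    have [N1 hN1] := hl e e0; have [N2 hN2] := ex_inv_lt e0.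
    set n := maxn N1 N2.
    have := hN1 n (leq_maxl _ _); have := inv_le_inv R (leq_maxr N1 N2 : (N2 <= n)%N).
    move=> h1 h2; have := dJ (x n + t%:C *: z); have := hx n.
    rewrite /J fD fZ (linear_D lD) (linear_Z lD) (rnorm_sqr (_ + _)) ripDl !ripDr
      !ripZl !ripZr -!rnorm_sqr -/k.
    have h3 : t * rip (D z) (D (x n)) <= t * rip (D z) l + `|t| * rnorm (D z) * e.
      rewrite -lerBlDl -mulrBr -ripBr (le_trans (ler_norm _)) // normrM -mulrA.
      apply: ler_wpM2l; rewrite ?normr_ge0 // (le_trans (rip_abs_le _ _)) //.
      by apply: ler_wpM2l; rewrite ?rnorm_ge0 // rnorm_distC ltW.
    rewrite (ripC (D (x n))) /g; move: h1 hN2;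
      move: (N2.+1%:R^-1) (n.+1%:R^-1) => a b h1 hN2 h4 h5; lra.
  have k1 : 0 < k + 1 by rewrite ltr_wpDl.
  (* Dividing by [k + 1] instead of [k] covers [D z = 0]; the value is a negative multiple of
     [g^2]. *)
  have := q (- g / (k + 1)).
  have -> : 2 * (- g / (k + 1)) * g + (- g / (k + 1)) ^+ 2 * k =
    - (g ^+ 2 * ((k + 2) / (k + 1) ^+ 2)) by field; rewrite gt_eqF.
  rewrite oppr_ge0 pmulr_lle0 ?divr_gt0 ?exprn_gt0 ?ltr_wpDl // => g0.
  by apply/eqP; rewrite eq_sym -subr_eq0 -/g -sqrf_eq0 eq_le g0 sqr_ge0.
exists l; split=> // [z|].
  (* The imaginary part of [phi z] is recovered from [f] at ['i *: z]. *)
  rewrite innerE -fE -(linear_Z lD) -fE /f phiZ.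
  by case: (phi z) => a b /=; rewrite mul0r mul1r sub0r opprK.
rewrite leNgt; apply/negP => cl0.
(* With [D z] close to [l], [|l|^2] is close to [f z], and [f z <= c |D z|]. *)
have : rnorm l * rnorm l <= c * rnorm l.
  apply: (@le_eps_mul _ _ _ (rnorm l + c)) => [|e e0]; first
    by rewrite addr_ge0 ?rnorm_ge0.
  have /rclosureP /(_ e e0)[_ [[z _ <-] lz]] := cl.
  rewrite -expr2 rnorm_sqr -[X in rip X](subrK (D z)) ripDl -fE.
  have h1 := rip_le (l - D z) l.
  have h2 := phi_le z; rewrite -/(f z) in h2.
  have h3 := rnorm_dist_tri l (D z) 0; rewrite !subr0 rnorm_distC in h3.
  have := rnorm_ge0 l; have := rnorm_ge0 (D z); move: c0; nra.
by rewrite leNgt ltr_pM2r ?cl0 // (le_lt_trans c0).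
Qed.

End Riesz.

Section Adjoint.
Variables (R : realType) (H : hilbertType R).
Implicit Types (T A X : H -> H).

Local Notation B_H := (bounded_op (inner : H -> H -> R[i])).

Lemma inner_ext (x y : H) : (forall z, inner z x = inner z y) -> x = y.
Proof.
move=> h; apply/eqP; rewrite -subr_eq0; apply/eqP/rip0_eq0.
by rewrite ripBr /rip h subrr.
Qed.

Lemma innerBl (x y z : H) : inner (x - y) z = inner x z - inner y z.
Proof. by rewrite innerDl -scaleN1r innerZl mulN1r. Qed.

(** Riesz with [D] the identity, applied to [x |-> <T x, y>]; linearity of [S] comes from uniqueness
    of the representing vector. *)
Lemma adjoint_exists T : B_H T ->
  exists S, B_H S /\ forall x y, inner (T x) y = inner x (S y).
Proof.
move=> /bounded_opP[lT [c [c0 hc]]].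
have /choice[S hS] : forall y, exists s,
    (forall x, inner (T x) y = inner x s) /\ rnorm s <= c * rnorm y.
  move=> y; have [] := @riesz_range R H H id (fun x => inner (T x) y) (c * rnorm y).
  - by [].
  - by move=> a u v; rewrite lT innerDl innerZl.
  - by rewrite mulr_ge0 ?rnorm_ge0.
  - move=> x; rewrite (le_trans (rip_le _ _)) // mulrAC.
    by rewrite ler_wpM2r ?rnorm_ge0.
  by move=> s [_ h1 h2]; exists s.
exists S; split; last by move=> x y; have [] := hS y.
apply/bounded_opP; split; last by exists c; split=> // y; have [] := hS y.
move=> a u v; apply: inner_ext => z; rewrite -(proj1 (hS _)).
rewrite [LHS]innerC innerDl innerZl !(innerC _ (T z)).
rewrite rmorphD rmorphM /= !conjcK.
rewrite [RHS]innerC innerDl innerZl !(innerC _ z).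
by rewrite rmorphD rmorphM /= !conjcK -!(proj1 (hS _)).
Qed.

Lemma adjointP T : B_H T -> B_H (adjoint (inner : H -> H -> R[i]) T) /\
  forall x y, inner (T x) y = inner x (adjoint (inner : H -> H -> R[i]) T y).
Proof.
move=> hT; rewrite /adjoint; case: xgetP => [S _ //|/= nS].
by have [S hS] := adjoint_exists hT; case: (nS S).
Qed.

End Adjoint.

(** * Lower semicontinuous seminorms *)

Section Gelfand.
Variables (R : realType) (H : hilbertType R) (p : H -> R).
Hypotheses (pB : forall x y, p (x - y) <= p x + p y)
  (pZ : forall (t : R) x, 0 <= t -> p (t%:C *: x) = t * p x)
  (p_closed : forall (a : R) y,
    (forall r : R, 0 < r -> exists y', rnorm (y - y') < r /\ p y' <= a) -> p y <= a).

(* If [p] is unbounded, every ball contains a smaller one on which [p > n]. *)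
Let shrink (n : nat) (s : H * R) :
  (forall c : R, exists x, c * rnorm x < p x) -> 0 < s.2 ->
  exists s' : H * R, [/\ 0 < s'.2, s'.2 <= n.+1%:R^-1,
    forall z, rnorm (s'.1 - z) <= s'.2 -> rnorm (s.1 - z) <= s.2
  & forall z, rnorm (s'.1 - z) <= s'.2 -> n%:R < p z].
Proof.
(* The constant is chosen so that [h0], rescaled to norm [r / 2], satisfies [p h > n + 1]. *)
case: s => x r /= hp r0; have [h0 hh0] := hp (2 * n.+1%:R / r).
have p0 : p 0 = 0 by have := pZ 0 (lexx 0); rewrite scale0r mul0r.
have h0n : 0 < rnorm h0.
  rewrite lt_def rnorm_ge0 andbT; apply/eqP => /rnorm0_eq0 e.
  by move: hh0; rewrite e p0 rnorm0 mulr0 ltxx.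
set t := r / 2 / rnorm h0; have t0 : 0 < t by rewrite !divr_gt0.
set h := t%:C *: h0.
have hn : rnorm h = r / 2.
  by rewrite rnormZ gtr0_norm // /t divfK // gt_eqF.
have ph : n%:R < p h.
  rewrite pZ ?ltW // (le_lt_trans (_ : _ <= n.+1%:R)) ?ler_nat //.
  have -> : n.+1%:R = t * (2 * n.+1%:R / r * rnorm h0).
    by rewrite /t; field; rewrite !gt_eqF.
  by rewrite ltr_pM2l.
(* Since [2 p h <= p (x + h) + p (x - h)], one of [x + h] and [x - h] will do. *)
have [y [xy py]] : exists y, rnorm (x - y) = r / 2 /\ n%:R < p y.
  have : 2 * p h <= p (x + h) + p (x - h).
    have := pB (x + h) (x - h).
    rewrite opprB addrC addrA subrK -pZ ?ler0n // => /(le_trans _); apply.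
    by rewrite -[X in X + _]scale1r -[X in _ + X]scale1r -scalerDl -rmorphD.
  case: (ltP n%:R (p (x + h))) => [h1 _|h1 h2].
    by exists (x + h); rewrite opprD addNKr rnormN.
  by exists (x - h); rewrite opprB addrC subrK; split=> //; lra.
(* The sublevel set of [p] at height [n] is closed, so its complement contains a ball around [y]. *)
have [r1 [r10 hr1]] : exists r1, 0 < r1 /\ forall z, rnorm (y - z) < r1 -> n%:R < p z.
  apply/not_existsP => hn'; move: py; apply/negP; rewrite -leNgt.
  apply: p_closed => r1 r10; have := hn' r1 => /not_andP[//|/existsNP[z]].
  by move=> /not_implyP[yz /negP]; rewrite -leNgt => pz; exists z.
(* [m <= r / 2] nests the balls, as [y] is at distance [r / 2] from [x]; [m < r1] keeps [p > n]; the
   remaining bound makes the centres converge. *)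
have [m [m0 m1 m2 m3]] : exists m : R, [/\ 0 < m, m <= n.+1%:R^-1, m < r1 & m <= r / 2].
  exists (Num.min n.+1%:R^-1 (Num.min (r1 / 2) (r / 2))).
  rewrite !lt_min invr_gt0 ltr0n /= !divr_gt0 //.
  by split=> //; rewrite ?ge_min ?gt_min ?lexx ?orbT // ltr_pdivrMr // mulr_natr
    mulr2n ltrDl r10 orbT.
exists (y, m); split=> //= z yz; last by apply: hr1; exact: le_lt_trans m2.
by have := rnorm_dist_tri y x z; lra.
Qed.

(** Gelfand's lemma. If [p] were unbounded, the nested balls given by [shrink] would have a common
    point at which [p] exceeds every integer. *)
Lemma gelfand_bounded : exists c : R, 0 <= c /\ forall x, p x <= c * rnorm x.
Proof.
have [[c hc]|/forallNP hp] := pselect (exists c : R, forall x, p x <= c * rnorm x).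
  exists `|c|; split=> // x; rewrite (le_trans (hc x)) // ler_wpM2r ?rnorm_ge0 //.
  exact: ler_norm.
have {}hp c : exists x, c * rnorm x < p x.
  by have /existsNP[x /negP] := hp c; rewrite -ltNge => ?; exists x.
have /choice[g hg] : forall ns : nat * (H * R), exists s' : H * R, 0 < ns.2.2 ->
    [/\ 0 < s'.2, s'.2 <= ns.1.+1%:R^-1,
    forall z, rnorm (s'.1 - z) <= s'.2 -> rnorm (ns.2.1 - z) <= ns.2.2
  & forall z, rnorm (s'.1 - z) <= s'.2 -> ns.1%:R < p z].
  move=> [n s] /=; have [s0|s0] := ltP 0 s.2; last by exists (0, 0).
  by have [s' hs'] := shrink n hp s0; exists s'.
pose s := fix s (n : nat) : H * R := if n is m.+1 then g (m, s m) else (0, 1).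
have s0 n : 0 < (s n).2 by elim: n => [|n IH] /=; [exact: ltr01|case: (hg (n, s n) IH)].
have nest m n z : rnorm ((s (m + n)%N).1 - z) <= (s (m + n)%N).2 ->
    rnorm ((s m).1 - z) <= (s m).2.
  elim: n => [|n IH]; first by rewrite addn0.
  by rewrite addnS; have [_ _ h _] := hg ((m + n)%N, s (m + n)%N) (s0 _); move=> /h /IH.
have close m n : (m <= n)%N -> rnorm ((s m).1 - (s n).1) <= (s m).2.
  move=> /subnKC <-; apply: (nest m (n - m)%N); rewrite subrr rnorm0 ltW //.
have [e e0|l hl] := @rcauchy_cvg R H (fun n => (s n).1).
  have [N hN] := ex_inv_lt e0; exists N.+1 => n Nn.
  have [_ h1 _ _] := hg (N, s N) (s0 _).
  by rewrite (le_lt_trans (close _ _ Nn)) // (le_lt_trans h1).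
have inball n : rnorm ((s n).1 - l) <= (s n).2.
  apply: (@le_eps_mul _ _ _ 1) => // e /hl[N hN]; rewrite mulr1.
  have := hN (maxn n N) (leq_maxr _ _); have := close n _ (leq_maxl n N).
  have := rnorm_dist_tri (s (maxn n N)).1 (s n).1 l;
    rewrite (rnorm_distC (s (maxn n N)).1 l); lra.
(* The ball with index [n.+1] is the one built to satisfy [p > n]. *)
have pl n : n%:R < p l.
  by have [_ _ _] := hg (n, s n) (s0 _); apply; exact: (inball n.+1).
have := pl (Num.bound (p l)); rewrite ltNge ltW // archi_boundP //.
exact: ltW (pl 0%N).
Qed.

End Gelfand.

(** * Positive operators, projections and the A-adjoint *)

Section Positive.
Variables (R : realType) (H : hilbertType R).
Implicit Types (T A X D : H -> H).

Local Notation B_H := (bounded_op (inner : H -> H -> R[i])).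
Local Notation adj := (adjoint (inner : H -> H -> R[i])).

Lemma positive_linear A : positive_op A -> linear A.
Proof. by case=> [[]]. Qed.

Lemma positive_rip_ge0 A x : positive_op A -> 0 <= rip (A x) x.
Proof. by case=> _ /(_ x); rewrite lecE => /andP[]. Qed.

(** Positivity makes every [<A w, w>] real; symmetry is the vanishing of its imaginary part at
    [w = x + i y]. *)
Lemma positive_ripC A x y : positive_op A -> rip (A x) y = rip x (A y).
Proof.
move=> hA; have lA := positive_linear hA.
have im w : rip ('i *: A w) w = 0.
  by case: hA => _ /(_ w); rewrite lecE ripil => /andP[/eqP -> _]; rewrite oppr0.
have := im (x + 'i *: y).
rewrite (linear_D lA) (linear_Z lA) scalerDr !ripDl !ripDr im rip_ii.
rewrite rip_ii scalerA -expr2 sqr_i scaleN1r !ripNl (ripiC _ y) => h.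
have := im y; rewrite ripiC (ripC x); lra.
Qed.

Lemma positive_inner A x y : positive_op A -> inner (A x) y = inner x (A y).
Proof.
move=> hA; rewrite !innerE (positive_ripC _ _ hA).
by rewrite -(linear_Z (positive_linear hA)) (positive_ripC _ _ hA).
Qed.

Lemma positive_CS A x y : positive_op A ->
  rip (A x) y ^+ 2 <= rip (A x) x * rip (A y) y.
Proof.
move=> hA; have lA := positive_linear hA.
apply: (@form_CS R H (fun x y => rip (A x) y)) => [u v w|t u v|u v|u].
- by rewrite (linear_D lA) ripDl.
- by rewrite (linear_Z lA) ripZl.
- by rewrite (positive_ripC _ _ hA) ripC.
- exact: positive_rip_ge0.
Qed.

Lemma closure_orth D m v :
  (forall z, rip (D z) v = 0) -> closure (range D) m -> rip m v = 0.
Proof.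
move=> h /rclosureP cm.
have le0 s : (forall e : R, 0 < e -> `|s| <= 0 + e * rnorm v) -> s = 0 :> R.
  by move=> /(le_eps_mul (rnorm_ge0 v)); rewrite normr_le0 => /eqP.
apply: le0 => e /cm[_ [[z _ <-] mz]].
rewrite -(subrK (D z) m) ripDl h addr0 add0r (le_trans (rip_abs_le _ _)) //.
by rewrite ler_wpM2r ?rnorm_ge0 // ltW.
Qed.

(** The projection of [x] is the Riesz vector of [z |-> <D z, x>], a functional dominated by
    [|x| |D z|]. *)
Lemma proj_exists D x : linear D ->
  exists y, closure (range D) y /\ forall m, closure (range D) m -> inner (x - y) m = 0.
Proof.
move=> lD; have [] := @riesz_range R H H D (fun z => inner (D z) x) (rnorm x) lD.
- by move=> a u v; rewrite lD innerDl innerZl.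
- exact: rnorm_ge0.
- by move=> z; rewrite mulrC rip_le.
move=> y [cy hy _]; exists y; split=> // m cm.
have o z : rip (D z) (x - y) = 0 by rewrite ripBr /rip hy subrr.
rewrite innerC innerE (closure_orth o cm) (_ : rip _ _ = 0) //.
  by rewrite oppr0 conjc0.
rewrite ripiC (@closure_orth D m ('i *: (x - y))) ?oppr0 // => z.
by rewrite -[LHS]opprK -ripiC -(linear_Z lD) o oppr0.
Qed.

(** The closure of R(A) is the orthogonal complement of ker A. For the converse, with [y] the
    projection of [m], the vector [m - y] is orthogonal to R(A), so [A] kills it, and it is then
    orthogonal to both [m] and [y]. *)
Lemma closure_range_positive A m : positive_op A ->
  closure (range A) m <-> forall v, A v = 0 -> rip m v = 0.
Proof.
move=> hA; split=> [cm v Av|h].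
  by apply: (closure_orth _ cm) => z; rewrite (positive_ripC _ _ hA) Av rip0r.
have [y [cy hy]] := proj_exists m (positive_linear hA).
suff -> : m = y by [].
have hy' z : closure (range A) z -> rip (m - y) z = 0 by move=> /hy; rewrite /rip => ->.
have A0 : A (m - y) = 0.
  apply: rip0_eq0; rewrite (positive_ripC _ _ hA); apply: hy'.
  by apply: subset_closure; exists (A (m - y)).
apply/eqP; rewrite -subr_eq0; apply/eqP/rip0_eq0.
by rewrite {1}ripBl h // ripC hy' // subrr.
Qed.

Lemma closure_range_linear A a x y : positive_op A ->
  closure (range A) x -> closure (range A) y -> closure (range A) (a *: x + y).
Proof.
move=> hA /(closure_range_positive _ hA) hx /(closure_range_positive _ hA) hy.
apply/(closure_range_positive _ hA) => v Av; rewrite ripDl hy // addr0.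
have xv : inner x v = 0.
  rewrite innerE hx // ripiC hx ?oppr0 // (linear_Z (positive_linear hA)) Av.
  by rewrite scaler0.
by rewrite /rip innerZl xv mulr0.
Qed.

(** The difference of [x] and [y] lies in ker A and in its orthogonal complement. This gives the
    uniqueness of values in the closure of R(A), from which linearity is deduced below. *)
Lemma closure_range_inj A x y : positive_op A ->
  closure (range A) x -> closure (range A) y -> A x = A y -> x = y.
Proof.
move=> hA cx cy e; apply/eqP; rewrite -subr_eq0; apply/eqP/rip0_eq0.
have := closure_range_linear (a := -1) hA cy cx; rewrite scaleN1r addrC.
move=> /(closure_range_positive _ hA); apply.
by rewrite (linear_B (positive_linear hA)) e subrr.
Qed.

Lemma projP A x : positive_op A -> closure (range A) (proj (closure (range A)) x) /\
  forall z, closure (range A) z -> inner (x - proj (closure (range A)) x) z = 0.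
Proof.
move=> hA; rewrite /proj; case: xgetP => [y _ //|/= ny].
by have [y hy] := proj_exists x (positive_linear hA); case: (ny y).
Qed.

Lemma proj_ker A x : positive_op A -> A (proj (closure (range A)) x) = A x.
Proof.
move=> hA; have [_ h] := projP x hA.
apply/esym/eqP; rewrite -subr_eq0 -(linear_B (positive_linear hA)); apply/eqP/rip0_eq0.
rewrite (positive_ripC _ _ hA) /rip h //; apply: subset_closure.
by eexists; last reflexivity.
Qed.

(** Douglas factorisation: [X x] is the preimage of [T^* A x] lying in the closure of R(A).
    Boundedness is Gelfand's lemma for [x |-> |X x|]. *)
Lemma sharp_exists A T : positive_op A -> B_A A T ->
  exists X, [/\ B_H X, A \o X = adj T \o A & range X `<=` closure (range A)].
Proof.
move=> hA [hT hr]; have lA := positive_linear hA.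
have [[lS _] hS] := adjointP hT.
have /choice[X hX] x : exists m, closure (range A) m /\ A m = adj T (A x).
  have [|w _ hw] := hr (adj T (A x)); first by exists x.
  by exists (proj (closure (range A)) w); rewrite proj_ker //; have [] := projP w hA.
have lX : linear X.
  move=> a x y; apply: (closure_range_inj hA).
  - by case: (hX (a *: x + y)).
  - by apply: closure_range_linear => //; case: (hX x); case: (hX y).
  - by rewrite lA !(proj2 (hX _)) lA lS.
exists X; split.
- apply/bounded_opP; split=> //.
  (* Tested against R(A), [X x] depends continuously on [x]; this yields lower semicontinuity of
     [|X x|]. *)
  have XA x z : rip (X x) (A z) = rip x (A (T z)).
    rewrite -(positive_ripC _ _ hA) (proj2 (hX _)) ripC {1}/rip -hS -/(rip _ _).
    by rewrite ripC (positive_ripC _ _ hA).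
  apply: gelfand_bounded => [x y|t x t0|a y hy].
  + by rewrite (linear_B lX) rnormB.
  + by rewrite (linear_Z lX) rnormZ ger0_norm.
  have a0 : 0 <= a by have [y' [_]] := hy 1 ltr01; apply: le_trans; exact: rnorm_ge0.
  have h1 z : rip (X y) (A z) <= a * rnorm (A z).
    apply: (@le_eps_mul _ _ _ (rnorm (A (T z)))) => [|e /hy[y' [yy' py']]].
      exact: rnorm_ge0.
    rewrite -(subrK y' y) (linear_D lX) ripDl (XA (y - y')) addrC; apply: lerD.
      by rewrite (le_trans (rip_le _ _)) // ler_wpM2r ?rnorm_ge0.
    by rewrite (le_trans (rip_le _ _)) // ler_wpM2r ?rnorm_ge0 // ltW.
  rewrite leNgt; apply/negP => ay.
  (* [X y] is in the closure of R(A), so [h1] can be used with [A z] close to [X y]. *)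
  have : rnorm (X y) * rnorm (X y) <= a * rnorm (X y).
    apply: (@le_eps_mul _ _ _ (rnorm (X y) + a)) => [|e e0].
      by rewrite addr_ge0 ?rnorm_ge0.
    have /rclosureP /(_ e e0)[_ [[z _ <-] lz]] := proj1 (hX y).
    rewrite -expr2 rnorm_sqr -[X in rip _ X](subrK (A z)) ripDr.
    have := rip_le (X y) (X y - A z); have := h1 z.
    have := rnorm_dist_tri (X y) (A z) 0; rewrite !subr0 rnorm_distC.
    have := rnorm_ge0 (X y); have := rnorm_ge0 (A z); move: a0 lz; nra.
  by rewrite leNgt ltr_pM2r ?ay // (le_lt_trans a0).
- by apply/funext => x /=; rewrite (proj2 (hX x)).
- by move=> _ [x _ <-]; case: (hX x).
Qed.

Lemma sharpP A T : positive_op A -> B_A A T ->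
  [/\ B_H (sharp A T), A \o sharp A T = adj T \o A &
      range (sharp A T) `<=` closure (range A)].
Proof.
move=> hA hT; rewrite /sharp; case: xgetP => [X _ //|/= nX].
by have [X hX] := sharp_exists hA hT; case: (nX X).
Qed.

End Positive.

(** * Square roots of positive operators *)

Section SquareRoot.
Variables (R : realType) (H : hilbertType R).
Implicit Types (A S : H -> H).

Local Notation B_H := (bounded_op (inner : H -> H -> R[i])).

Lemma positive_of_rip S : B_H S -> (forall x y, rip (S x) y = rip x (S y)) ->
  (forall x, 0 <= rip (S x) x) -> positive_op S.
Proof.
move=> bS sS pS; split=> // x; have lS := proj1 bS.
rewrite innerE (_ : rip ('i *: S x) x = 0) ?oppr0 ?lecE /= ?eqxx /=; first exact: pS.
have := sS ('i *: x) x; rewrite (linear_Z lS) (ripiC x) (ripC x) => h.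
have {h} : rip ('i *: S x) x = - rip ('i *: S x) x := h; lra.
Qed.

Lemma rlim_unique (u : nat -> H) l l' :
  (forall e : R, 0 < e -> exists N, forall n, (N <= n)%N -> rnorm (l - u n) <= e) ->
  (forall e : R, 0 < e -> exists N, forall n, (N <= n)%N -> rnorm (l' - u n) <= e) ->
  l = l'.
Proof.
move=> h h'; apply/eqP; rewrite -subr_eq0; apply/eqP/rnorm0_eq0/eqP.
rewrite eq_le rnorm_ge0 andbT.
apply: (@le_eps_mul _ _ _ 2) => // e e0; rewrite add0r.
have [N hN] := h e e0; have [N' hN'] := h' e e0.
have := hN (maxn N N') (leq_maxl _ _); have := hN' (maxn N N') (leq_maxr _ _).
have := rnorm_dist_tri (u (maxn N N')) l l'; rewrite (rnorm_distC (u _) l'); lra.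
Qed.

Lemma rnormZc (a : R[i]) (x : H) : rnorm (a *: x) = complex.Re `|a| * rnorm x.
Proof.
rewrite /rnorm normrZ rnormE normc_def /= mul0r subr0.
by rewrite -[X in _ = _ * X]/(complex.Re (rnorm x)%:C).
Qed.

Section Contraction.
Variable A : H -> H.
Hypotheses (hA : positive_op A) (A_le : forall x, rnorm (A x) <= rnorm x).

Let B x := x - A x.

Let lB : linear B.
Proof.
move=> a x y; rewrite /B (positive_linear hA) scalerBr opprD.
by rewrite addrACA.
Qed.

Let B_le x : rnorm (B x) <= rnorm x.
Proof.
rewrite -ler_sqr ?nnegrE ?rnorm_ge0 // !rnorm_sqr /B ripBl !ripBr (ripC x).
(* This follows from Cauchy-Schwarz for [<A u, v>] at [A x] and [x], together with [|A| <= 1]. *)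
suff : rip (A x) (A x) <= rip (A x) x by have := rip_ge0 (A x); lra.
have [->|Ax0] := eqVneq (rip (A x) (A x)) 0; first exact: positive_rip_ge0.
have Ax1 : 0 < rip (A x) (A x) by rewrite lt_def Ax0 rip_ge0.
rewrite -(ler_pM2r Ax1) -expr2 [X in X ^+ 2](positive_ripC _ _ hA).
rewrite ripC (le_trans (positive_CS (A x) x hA)) // mulrC ler_wpM2l
  ?positive_rip_ge0 //.
by rewrite (le_trans (rip_le _ _)) // -rnorm_sqr expr2 ler_wpM2r ?rnorm_ge0.
Qed.

Let sB x y : rip (B x) y = rip x (B y).
Proof. by rewrite /B ripBl ripBr (positive_ripC _ _ hA). Qed.

(* [I - (I - B)^(1/2)] is the fixed point of [Y -> (B + Y^2) / 2]; the operator
   iterates are dominated by the scalar ones, obtained for [B = 1]. *)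
Let Y := fix Y n x : H := if n is m.+1 then 2^-1%:C *: (B x + Y m (Y m x)) else 0.
Let y := fix y n : R := if n is m.+1 then 2^-1 * (1 + y m ^+ 2) else 0.

Let YS n x : Y n.+1 x = 2^-1%:C *: (B x + Y n (Y n x)).
Proof. by []. Qed.

Let y01 n : 0 <= y n <= 1.
Proof. elim: n => [|n /andP[h0 h1]] /=; [lra|nra]. Qed.

Let y_nd n : y n <= y n.+1.
Proof. by rewrite /=; have := sqr_ge0 (y n - 1); nra. Qed.

Let lY n : linear (Y n).
Proof.
elim: n => [|n IH] a u v /=; first by rewrite scaler0 addr0.
rewrite lB !IH !scalerDr !scalerA mulrC; set s := (a * _).
by rewrite [RHS]addrACA.
Qed.

Let Y_le n x : rnorm (Y n x) <= y n * rnorm x.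
Proof.
elim: n x => [|n IH] x /=; first by rewrite rnorm0 mul0r.
rewrite rnormZ ger0_norm ?invr_ge0 // -mulrA ler_wpM2l ?invr_ge0 //.
rewrite (le_trans (rnormD _ _)) // mulrDl mul1r lerD // expr2 -mulrA.
by rewrite (le_trans (IH _)) // ler_wpM2l //; have /andP[] := y01 n.
Qed.

Let YB n x : Y n (B x) = B (Y n x).
Proof.
elim: n x => [|n IH] x /=; first by rewrite (linear_0 lB).
by rewrite (linear_Z lB) (linear_D lB (B x)) !IH.
Qed.

Let YY n x : Y n.+1 (Y n x) = Y n (Y n.+1 x).
Proof. by rewrite /= (linear_Z (lY n)) (linear_D (lY n)) YB. Qed.

Let sY n x z : rip (Y n x) z = rip x (Y n z).
Proof.
elim: n x z => [|n IH] x z /=; first by rewrite rip0l rip0r.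
by rewrite ripZl ripZr ripDl ripDr sB !IH.
Qed.

(** Consecutive iterates commute, so a difference of squares factors: [Y n.+2 - Y n.+1] is half of
    [Y n.+1 - Y n] applied to [Y n.+1 + Y n], just as for the scalars [y n]. *)
Let Y_step n x : rnorm (Y n.+1 x - Y n x) <= (y n.+1 - y n) * rnorm x.
Proof.
elim: n x => [|n IH] x.
  by have := Y_le 1 x; rewrite [Y 0 x]/= [y 0]/= !subr0.
have -> : Y n.+2 x - Y n.+1 x =
    2^-1%:C *: (Y n.+1 (Y n.+1 x + Y n x) - Y n (Y n.+1 x + Y n x)).
  rewrite (YS n.+1 x) [in X in _ - X](YS n x) -scalerBr; congr (_ *: _).
  rewrite (linear_D (lY n.+1)) (linear_D (lY n)) -YY.
  by rewrite opprD addrACA subrr add0r opprD addrA addrK.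
rewrite rnormZ ger0_norm ?invr_ge0 //.
have -> : y n.+2 - y n.+1 = 2^-1 * ((y n.+1 - y n) * (y n.+1 + y n))
  by rewrite /=; ring.
rewrite -!mulrA ler_wpM2l ?invr_ge0 // (le_trans (IH _)) // ler_wpM2l ?subr_ge0 //.
by rewrite (le_trans (rnormD _ _)) // mulrDl lerD.
Qed.

Let Y_dist n k x : rnorm (Y (n + k) x - Y n x) <= (y (n + k) - y n) * rnorm x.
Proof.
elim: k => [|k IH]; first by rewrite addn0 !subrr rnorm0 mul0r.
rewrite addnS; have := rnorm_dist_tri (Y (n + k) x) (Y (n + k).+1 x) (Y n x).
have := Y_step (n + k) x; move: IH.
move: (y (n + k)) (y (n + k).+1) => a b; nra.
Qed.

(** The scalars [y n] are nondecreasing and bounded by 1, hence Cauchy; [Y_dist] turns this into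
    convergence in operator norm. *)
Let L_exists : exists L : H -> H, forall e : R, 0 < e ->
  exists N, forall n, (N <= n)%N -> forall x, rnorm (L x - Y n x) <= e * rnorm x.
Proof.
have hs : has_sup (range y).
  split; first by exists (y 0), 0.
  by exists 1 => _ [n _ <-]; have /andP[] := y01 n.
have yd e : 0 < e -> exists N, forall n, (N <= n)%N -> forall k, y (n + k) - y n < e.
  move=> e0; have [_ [N _ <-] hN] := sup_adherent e0 hs.
  exists N => n Nn k; have h1 : y (n + k) <= sup (range y).
    by apply: sup_upper_bound => //; exists (n + k)%N.
  suff h2 : y N <= y n by lra.
  rewrite -(subnKC Nn); elim: (n - N)%N => [|j IH]; first by rewrite addn0.
  by rewrite addnS (le_trans IH).
have /choice[L hL] : forall x, exists l, forall e : R, 0 < e ->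
    exists N, forall n, (N <= n)%N -> rnorm (l - Y n x) < e.
  move=> x; apply: rcauchy_cvg => e e0.
  have x1 : 0 < rnorm x + 1 by rewrite ltr_wpDl ?rnorm_ge0.
  have [|N hN] := yd (e / (rnorm x + 1)); first by rewrite divr_gt0.
  exists N => n /subnKC <-; rewrite rnorm_distC (le_lt_trans (Y_dist _ _ _)) //.
  have := hN N (leqnn N) (n - N)%N; rewrite ltr_pdivlMr // => /le_lt_trans; apply.
  rewrite ler_wpM2l ?lerDl //; rewrite subr_ge0.
  elim: (n - N)%N => [|j IH]; first by rewrite addn0.
  by rewrite addnS (le_trans IH).
exists L => e /yd[N hN]; exists N => n Nn x.
apply: (@le_eps_mul _ _ _ 1) => // d /(hL x)[M hM]; rewrite mulr1.
have := rnorm_dist_tri (Y (n + M) x) (L x) (Y n x).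
have := hM _ (leq_addl n M); have := Y_dist n M x.
have : (y (n + M) - y n) * rnorm x <= e * rnorm x.
  by rewrite ler_wpM2r ?rnorm_ge0 // ltW // hN.
lra.
Qed.

(** The limit satisfies [2 L = B + L^2], so [(I - L)^2 = I - B = A]; positivity of [I - L] is
    [|L| <= 1]. *)
Lemma sqrt_contraction : exists S, positive_op S /\ S \o S = A.
Proof.
have [L hL] := L_exists.
have cvL x (e : R) : 0 < e ->
    exists N, forall n, (N <= n)%N -> rnorm (L x - Y n x) <= e.
  move=> e0; have x1 : 0 < rnorm x + 1 by rewrite ltr_wpDl ?rnorm_ge0.
  have [|N hN] := hL (e / (rnorm x + 1)); first by rewrite divr_gt0.
  exists N => n Nn; rewrite (le_trans (hN n Nn x)) //.
  by rewrite -mulrA ger_pMr // mulrC ler_pdivrMr // mul1r lerDl.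
have lL : linear L.
  move=> a u v; apply: (rlim_unique (cvL _)) => e e0.
  set k := complex.Re `|a|.
  have k0 : 0 <= k by rewrite /k normc_def /= sqrtr_ge0.
  have e1 : 0 < e / (k + 1) by rewrite divr_gt0 // ltr_wpDl.
  have [N hN] := cvL u _ (divr_gt0 e1 (ltr0n _ 2)).
  have [M hM] := cvL v _ (divr_gt0 e0 (ltr0n _ 2)).
  exists (maxn N M) => n; rewrite geq_max => /andP[/hN h1 /hM h2].
  rewrite lY opprD addrACA -scalerBr (le_trans (rnormD _ _)) // rnormZc -/k.
  have h3 : k * rnorm (L u - Y n u) <= e / 2.
    rewrite (le_trans (ler_wpM2l k0 h1)) // mulrA ler_wpM2r ?invr_ge0 //.
    by rewrite mulrCA ger_pMr // ler_pdivrMr ?ltr_wpDl // mul1r lerDl.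
  lra.
have L_le x : rnorm (L x) <= rnorm x.
  apply: (@le_eps_mul _ _ _ 1) => // e /(cvL x)[N /(_ N (leqnn N)) hN].
  have := rnorm_dist_tri (Y N x) (L x) 0; rewrite !subr0 mulr1.
  have := Y_le N x; have /andP[_ h] := y01 N.
  have := ler_wpM2r (rnorm_ge0 x) h; lra.
have sL x z : rip (L x) z = rip x (L z).
  apply/eqP; rewrite -subr_eq0 -normr_le0.
  apply: (@le_eps_mul _ _ _ (rnorm z + rnorm x)) => [|e e0].
    by rewrite addr_ge0 ?rnorm_ge0.
  have [N hN] := cvL x e e0; have [M hM] := cvL z e e0; set n := maxn N M.
  have -> : rip (L x) z - rip x (L z) = rip (L x - Y n x) z - rip x (L z - Y n z).
    by rewrite ripBl ripBr sY; ring.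
  rewrite add0r (le_trans (ler_normB _ _)) // mulrDr lerD //.
    rewrite (le_trans (rip_abs_le _ _)) // ler_wpM2r ?rnorm_ge0 //.
    by rewrite hN // leq_maxl.
  rewrite (le_trans (rip_abs_le _ _)) // mulrC ler_wpM2r ?rnorm_ge0 //.
  by rewrite hM // leq_maxr.
have fixL x : L x + L x = B x + L (L x).
  apply/eqP; rewrite -subr_eq0; apply/eqP/rnorm0_eq0/eqP.
  rewrite eq_le rnorm_ge0 andbT.
  (* Two errors at [x] for [Y N.+1], one at [L x] and one inside [Y N], each at most [e |x|].
     Uniformity of the convergence allows one [N] for both [x] and [L x]. *)
  apply: (@le_eps_mul _ _ _ (4 * rnorm x)) => [|e e0]; first
    by rewrite mulr_ge0 ?rnorm_ge0.
  rewrite add0r; have [N hN] := hL e e0.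
  have h1 := hN N.+1 (leqnSn N) x; have h2 := hN N (leqnn N) (L x).
  have h3 : rnorm (Y N (L x - Y N x)) <= e * rnorm x.
    rewrite (le_trans (Y_le _ _)) // (le_trans _ (hN N (leqnn N) x)) //.
    by rewrite ler_piMl ?rnorm_ge0 //; have /andP[] := y01 N.
  (* Subtracts the recursion [2 Y N.+1 = B + (Y N)^2]. *)
  have -> : L x + L x - (B x + L (L x)) = (L x - Y N.+1 x) + (L x - Y N.+1 x) -
     ((L (L x) - Y N (L x)) + Y N (L x - Y N x)).
    rewrite (linear_B (lY N) (L x)) [in X in _ = _ - X]addrA subrK addrACA -opprD.
    have -> : Y N.+1 x + Y N.+1 x = B x + Y N (Y N x).
      by rewrite YS -scalerDl -rmorphD (_ : 2^-1 + 2^-1 = 1) ?scale1r //; field.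
    have e4 (u v w t : H) : u - (v + w) - (t - w) = u - (v + t).
      by rewrite -addrA -opprD addrACA subrr addr0.
    by rewrite e4.
  have := rnormB (L x - Y N.+1 x + (L x - Y N.+1 x))
    (L (L x) - Y N (L x) + Y N (L x - Y N x)).
  have := rnormD (L x - Y N.+1 x) (L x - Y N.+1 x).
  have := rnormD (L (L x) - Y N (L x)) (Y N (L x - Y N x)).
  have := ler_wpM2l (ltW e0) (L_le x).
  move: h1 h2 h3; lra.
exists (fun x => x - L x); split.
  apply: positive_of_rip.
  - apply/bounded_opP; split.
      by move=> a u v; rewrite lL scalerBr opprD addrACA.
    exists 2; split=> // x; rewrite (le_trans (rnormB _ _)) //.
    by have := L_le x; lra.
  - by move=> u v; rewrite ripBl ripBr sL.
  - move=> x; rewrite ripBl subr_ge0 (le_trans (rip_le _ _)) //.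
    by rewrite -rnorm_sqr expr2 ler_wpM2r ?rnorm_ge0.
apply/funext => x /=; rewrite (linear_B lL) opprB.
have -> : x - L x + (L (L x) - L x) = x + L (L x) - (L x + L x).
  by rewrite opprD addrACA.
by rewrite fixL opprD addrACA subrr addr0 /B opprB addrC subrK.
Qed.

End Contraction.

(** [A / k] with [k = c + 1] is a contraction; its root is multiplied by the square root of [k]. *)
Lemma sqrt_exists A : positive_op A -> exists S, positive_op S /\ S \o S = A.
Proof.
move=> hA; have lA := positive_linear hA.
have [_ [c [c0 hc]]] := proj1 (bounded_opP A) (proj1 hA).
have k0 : 0 < c + 1 by rewrite ltr_wpDl.
set k := c + 1 in k0.
have scale_pos (t : R) (F : H -> H) : 0 <= t -> positive_op F ->
    positive_op (fun x => t%:C *: F x).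
  move=> t0 hF; have [lF [d [d0 hd]]] := proj1 (bounded_opP F) (proj1 hF).
  apply: positive_of_rip.
  - apply/bounded_opP; split.
      by move=> a u v; rewrite lF scalerDr !scalerA mulrC.
    exists (t * d); split; first exact: mulr_ge0.
    by move=> x; rewrite rnormZ ger0_norm // -mulrA ler_wpM2l.
  - by move=> u v; rewrite ripZl ripZr (positive_ripC _ _ hF).
  - by move=> x; rewrite ripZl mulr_ge0 // positive_rip_ge0.
have [|x|S [hS SS]] := @sqrt_contraction (fun x => (k^-1)%:C *: A x).
- by apply: scale_pos => //; rewrite invr_ge0 ltW.
- rewrite rnormZ gtr0_norm ?invr_gt0 // ler_pdivrMl //.
  by rewrite (le_trans (hc x)) // ler_wpM2r ?rnorm_ge0 // lerDl.
exists (fun x => (Num.sqrt k)%:C *: S x); split.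
  by apply: scale_pos => //; exact: sqrtr_ge0.
apply/funext => x /=; rewrite (linear_Z (positive_linear hS)) scalerA -rmorphM.
have := congr1 (fun F => F x) SS => /= ->.
by rewrite scalerA -rmorphM -expr2 sqr_sqrtr ?ltW // divff ?gt_eqF // scale1r.
Qed.

Lemma sqrt_opP A : positive_op A -> positive_op (sqrt_op A) /\ sqrt_op A \o
  sqrt_op A = A.
Proof.
move=> hA; rewrite /sqrt_op; case: xgetP => [S _ //|/= nS].
by have [S hS] := sqrt_exists hA; case: (nS S).
Qed.

End SquareRoot.

(** * Boundedness for the semi-norm *)

Section SemiAdjoint.
Variables (R : realType) (H : hilbertType R).
Implicit Types (A T X : H -> H).

Local Notation B_H := (bounded_op (inner : H -> H -> R[i])).

(** If [r = (1 + d) K] with [d > 0], Bernoulli's inequality makes the powers of [r / K] unbounded,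
    whereas [C / a] bounds them. Exponents are powers of 2 because Cauchy-Schwarz doubles them. *)
Lemma le_of_pow2_le (r K a C : R) : 0 < K -> 0 < a ->
  (forall k, r ^+ (2 ^ k) * a <= C * K ^+ (2 ^ k)) -> r <= K.
Proof.
move=> K0 a0 h; rewrite leNgt; apply/negP => Kr.
set d := r / K - 1; have d0 : 0 < d by rewrite subr_gt0 ltr_pdivlMr // mul1r.
have bern n : 1 + n%:R * d <= (1 + d) ^+ n.
  elim: n => [|n IH]; first by rewrite mul0r addr0 expr0.
  have h1 : 0 <= n%:R * d * d by rewrite !mulr_ge0 ?ler0n // ltW.
  rewrite exprS (le_trans _ (ler_wpM2l (addr_ge0 ler01 (ltW d0)) IH)) // -natr1.
  by move: h1; move: (n%:R) => s; nra.
have hk k : k%:R * d <= C / a.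
  rewrite ler_pdivlMr // -(ler_pM2r (exprn_gt0 (2 ^ k) K0)) (le_trans _ (h k)) //.
  rewrite mulrAC ler_pM2r // -ler_pdivlMr ?exprn_gt0 // -expr_div_n.
  rewrite (_ : r / K = 1 + d); last by rewrite /d addrC subrK.
  rewrite (le_trans _ (bern _)) // (le_trans (_ : _ <= (2 ^ k)%:R * d)) ?lerDr //.
  by apply: ler_wpM2r; [exact: ltW|rewrite ler_nat ltnW // ltn_expl].
have Ca0 : 0 <= C / a / d.
  by have := hk 0; rewrite mul0r => h0; rewrite divr_ge0 // ltW.
have := archi_boundP Ca0; rewrite ltr_pdivrMr // => /lt_le_trans /(_ (hk _)).
by rewrite ltxx.
Qed.

(* The Lax - Krein - Reid argument: [G = X T] is symmetric for [<.,.>_A], so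
   the sequence [<G^(2^k) x, x>_A] dominates [(<G x, x>_A / <x, x>_A)^(2^k)],
   whereas it is at most of order [|G|^(2^k)]. *)
Lemma semi_bounded A T X : positive_op A -> B_H T -> B_H X ->
  (forall x y, inner (A (T x)) y = inner (A x) (X y)) ->
  exists c : R, 0 <= c /\ forall x, rip (A (T x)) (T x) <= c * rip (A x) x.
Proof.
move=> hA /bounded_opP[lT [cT [cT0 hT]]] /bounded_opP[lX [cX [cX0 hX]]] TX.
have [lA [cA [cA0 hcA]]] := proj1 (bounded_opP A) (proj1 hA).
(* A bound for the norm of [G = X T], enlarged to be positive. *)
set K := cX * cT + 1; have K0 : 0 < K by rewrite ltr_wpDl // mulr_ge0.
exists K; split=> [|x]; first exact: ltW.
pose G y := X (T y).
have rTX u v : rip (A (T u)) v = rip (A u) (X v) by rewrite /rip TX.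
have G_le y : rnorm (G y) <= K * rnorm y.
  rewrite (le_trans (hX _)) // (le_trans (ler_wpM2l cX0 (hT y))) // mulrA.
  by rewrite ler_wpM2r ?rnorm_ge0 // lerDl.
have sG u v : rip (A (G u)) v = rip (A u) (G v).
  have e w z : rip (A w) (G z) = rip (A (T w)) (T z) by rewrite rTX.
  by rewrite e (positive_ripC (G u)) // ripC e (positive_ripC (T v)) // ripC.
have Gn_le n y : rnorm (iter n G y) <= K ^+ n * rnorm y.
  elim: n => [|n IH] /=; first by rewrite expr0 mul1r.
  by rewrite (le_trans (G_le _)) // exprS -mulrA ler_wpM2l // ltW.
have sGn n u v : rip (A (iter n G u)) v = rip (A u) (iter n G v).
  by elim: n u v => [|n IH] u v //=; rewrite sG IH -iterS iterSr.
have -> : rip (A (T x)) (T x) = rip (A (G x)) x by rewrite sG -rTX.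
have CS n : rip (A (iter n G x)) x ^+ 2 <= rip (A x) x * rip (A (iter (n + n) G x)) x.
  rewrite iterD [X in _ <= _ * X]sGn mulrC.
  exact: positive_CS.
(* When [<x, x>_A = 0] the quotient [r] is meaningless, but [CS] alone gives [<G x, x>_A = 0]. *)
have [a0|a0] := eqVneq (rip (A x) x) 0.
  rewrite a0 mulr0; have := CS 1%N; rewrite a0 mul0r => h.
  suff -> : rip (A (G x)) x = 0 by [].
  by apply/eqP; rewrite -sqrf_eq0 eq_le h sqr_ge0.
have a1 : 0 < rip (A x) x by rewrite lt_def a0 positive_rip_ge0.
rewrite -ler_pdivrMr //.
have b0 : 0 <= rip (A (G x)) x by rewrite sG -rTX positive_rip_ge0.
set r := rip (A (G x)) x / rip (A x) x; have r0 : 0 <= r by rewrite divr_ge0 // ltW.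
apply: (@le_of_pow2_le _ _ (rip (A x) x) (cA * rnorm x ^+ 2)) => // k.
apply: (@le_trans _ _ (rip (A (iter (2 ^ k) G x)) x)); last first.
  rewrite (le_trans (rip_le _ _)) // expr2 mulrA [X in _ <= X]mulrAC.
  rewrite ler_wpM2r ?rnorm_ge0 // -mulrA (mulrC (rnorm x)).
  by rewrite (le_trans (hcA _)) // ler_wpM2l.
elim: k => [|k IH].
  by rewrite expn0 expr1 /= /r divfK.
have ra0 : 0 <= r ^+ (2 ^ k) * rip (A x) x by rewrite mulr_ge0 ?exprn_ge0 // ltW.
have := CS (2 ^ k)%N; rewrite addnn -mul2n -expnS => h.
rewrite -(ler_pM2l a1) (le_trans _ h) //.
have -> : rip (A x) x * (r ^+ (2 ^ k.+1) * rip (A x) x) =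
    (r ^+ (2 ^ k) * rip (A x) x) ^+ 2.
  by rewrite expnS mulnC exprM; ring.
by rewrite ler_sqr ?nnegrE // (le_trans ra0).
Qed.

(** Complex polarisation: the real form [rip ('i *: F x) y] is antisymmetric by [s2] and symmetric
    by [s3], hence zero; then take [y = i F x]. *)
Lemma quad_form_eq0 (F : H -> H) : linear F -> (forall x, inner (F x) x = 0) ->
  forall x, F x = 0.
Proof.
move=> lF h.
have q1 x : rip (F x) x = 0 by rewrite /rip h.
have q2 x : rip ('i *: F x) x = 0 by rewrite ripil h oppr0.
have s1 x y : rip (F x) y = - rip (F y) x.
  have := q1 (x + y); rewrite (linear_D lF) ripDl !ripDr !q1; lra.
have s2 x y : rip ('i *: F x) y = - rip ('i *: F y) x.
  have := q2 (x + y); rewrite (linear_D lF) scalerDr ripDl !ripDr !q2; lra.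
have s3 x y : rip ('i *: F x) y = rip ('i *: F y) x.
  by have := s1 ('i *: x) y; rewrite (linear_Z lF) (ripiC (F y)).
move=> x; apply: rip0_eq0; rewrite -rip_ii.
have := s2 x ('i *: F x); have := s3 x ('i *: F x); lra.
Qed.

End SemiAdjoint.

(** * Operators on R(A^(1/2)) *)

Section RangeSqrt.
Variables (R : realType) (H : hilbertType R) (A : H -> H) (hA : positive_op A).
Implicit Types (T X N : H -> H) (u v w : range_sqrt A).

Local Notation B_H := (bounded_op (inner : H -> H -> R[i])).
Local Notation S := (sqrt_op A).
Local Notation M := (closure (range A)).
Local Notation ip := (range_sqrt_inner (A := A)).

Let hS : positive_op S. Proof. by have [] := sqrt_opP hA. Qed.
Let lS : linear S. Proof. exact: positive_linear hS. Qed.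
Let lA : linear A. Proof. exact: positive_linear hA. Qed.

Lemma sqrt_opK x : S (S x) = A x.
Proof. by have [_ e] := sqrt_opP hA; have := congr1 (fun F => F x) e. Qed.

Lemma sqrt_op_ker x : S x = 0 <-> A x = 0.
Proof.
rewrite -sqrt_opK; split=> [->|e]; first exact: linear_0.
by apply: rip0_eq0; rewrite (positive_ripC _ _ hS) e rip0r.
Qed.

(** Both closures are orthogonal complements of kernels, and [S] and [A] have the same kernel. *)
Lemma closure_range_sqrt m : closure (range S) m <-> M m.
Proof.
split=> [/(closure_range_positive _ hS) h|/(closure_range_positive _ hA) h].
  by apply/(closure_range_positive _ hA) => v /sqrt_op_ker; exact: h.
by apply/(closure_range_positive _ hS) => v /sqrt_op_ker; exact: h.
Qed.

Lemma sqrt_op_closure x : M (S x).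
Proof. by apply/closure_range_sqrt; apply: subset_closure; exists x. Qed.

(* The unitary [A^(1/2) x |-> P x] of R(A^(1/2)) onto the closure of R(A). *)
Definition rep u : H := proj M (xget 0 [set x | S x = val u]).

Lemma repP u : M (rep u) /\ S (rep u) = val u.
Proof.
have [m1 m2] := projP (xget 0 [set x | S x = val u]) hA; split=> //.
have e : A (rep u) = A (xget 0 [set x | S x = val u]) by rewrite /rep proj_ker.
have <- : S (xget 0 [set x | S x = val u]) = val u.
  have /set_mem[x _ hx] := range_sqrt_valP u.
  by case: xgetP => [z _ //|/(_ x)]; rewrite /= hx.
apply/eqP; rewrite -subr_eq0 -(linear_B lS); apply/eqP/sqrt_op_ker.
by rewrite (linear_B lA) e subrr.
Qed.

Lemma rep_uniq u m : M m -> S m = val u -> rep u = m.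
Proof.
have [c e] := repP u => cm em; apply: (closure_range_inj hA) => //.
by rewrite -!sqrt_opK e em.
Qed.

Lemma rep_linear : linear rep.
Proof.
move=> a u v; have [cu eu] := repP u; have [cv ev] := repP v.
by apply: rep_uniq; [exact: closure_range_linear|rewrite lS eu ev linearP].
Qed.

Lemma rep_inj u v : rep u = rep v -> u = v.
Proof.
by move=> e; apply: val_inj; rewrite -(proj2 (repP u)) -(proj2 (repP v)) e.
Qed.

Lemma rep_range u x : val u = A x -> rep u = S x.
Proof.
by move=> e; apply: rep_uniq; [exact: sqrt_op_closure|rewrite sqrt_opK].
Qed.

(** Defined on all of H to avoid carrying membership proofs; it inverts [rep] only on [M]. *)
Definition of_rep (m : H) : range_sqrt A :=
  RangeSqrt (mem_set (ex_intro2 _ _ m I erefl : range S (S m))).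

Lemma of_repK m : M m -> rep (of_rep m) = m.
Proof. by move=> cm; apply: rep_uniq. Qed.

Lemma of_rep_range x : val (of_rep (S x)) = A x.
Proof. exact: sqrt_opK. Qed.

Lemma bounded_range_sqrtP (N : range_sqrt A -> range_sqrt A) :
  bounded_op ip N <-> linear N /\
  exists c : R, 0 <= c /\ forall u, rnorm (rep (N u)) <= c * rnorm (rep u).
Proof.
apply: (bounded_op_realP _ (n := fun u => rnorm (rep u))) => u; first exact: rnorm_ge0.
by rewrite rnorm_sqr -inner_xx.
Qed.

(** Density of R(A) in R(A^(1/2)): [rep] sends [A x] to [S x], and the vectors [S x] are dense in
    [M]. *)
Lemma range_dense_eq0 (g : range_sqrt A -> R) (c : R) : 0 <= c ->
  (forall u w, g (u - w) = g u - g w) ->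
  (forall u, `|g u| <= c * rnorm (rep u)) ->
  (forall u x, val u = A x -> g u = 0) -> forall u, g u = 0.
Proof.
move=> c0 gB gle g0 u; apply/eqP; rewrite -normr_le0.
apply: (le_eps_mul c0) => e e0; rewrite add0r.
have /closure_range_sqrt /rclosureP /(_ e e0)[_ [[x _ <-] hx]] := proj1 (repP u).
have -> : g u = g (u - of_rep (S x)) by rewrite gB (g0 _ x (of_rep_range x)) subr0.
rewrite (le_trans (gle _)) // mulrC ler_wpM2r // (linear_B rep_linear).
by rewrite of_repK ?ltW //; exact: sqrt_op_closure.
Qed.

Lemma range_dense_agree (N1 N2 : range_sqrt A -> range_sqrt A) :
  bounded_op ip N1 -> bounded_op ip N2 ->
  (forall u x, val u = A x -> N1 u = N2 u) -> N1 = N2.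
Proof.
move=> /bounded_range_sqrtP[l1 [c1 [c10 h1]]] /bounded_range_sqrtP[l2 [c2 [c20 h2]]] e.
suff h z u : rip (rep (N1 u) - rep (N2 u)) z = 0.
  by apply/funext => u; apply: rep_inj; apply/eqP; rewrite -subr_eq0;
    apply/eqP/rip0_eq0.
move: u; have c0 : 0 <= (c1 + c2) * rnorm z by rewrite mulr_ge0 ?addr_ge0 ?rnorm_ge0.
apply: (range_dense_eq0 (g := fun u => rip (rep (N1 u) - rep (N2 u)) z) c0)
  => [u w|u|u x ux].
- rewrite (linear_B l1) (linear_B l2) !(linear_B rep_linear) !ripBl; ring.
- rewrite (le_trans (rip_abs_le _ _)) // mulrAC ler_wpM2r ?rnorm_ge0 //.
  by rewrite (le_trans (rnormB _ _)) // mulrDl lerD.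
- by rewrite (e u x) // subrr rip0l.
Qed.

Lemma bounded_range_sqrt_comp (N1 N2 : range_sqrt A -> range_sqrt A) :
  bounded_op ip N1 -> bounded_op ip N2 -> bounded_op ip (N1 \o N2).
Proof.
move=> /bounded_range_sqrtP[l1 [c1 [c10 h1]]] /bounded_range_sqrtP[l2 [c2 [c20 h2]]].
apply/bounded_range_sqrtP; split=> [a u v|]; first by rewrite /= l2 l1.
exists (c1 * c2); split=> [|u /=]; first exact: mulr_ge0.
by rewrite (le_trans (h1 _)) // -mulrA ler_wpM2l.
Qed.

(** All that the results on [tilde] use of the pair [T], [sharp A T]; the relation is symmetric, so
    what holds for [T] transfers to [X]. *)
Definition semi_adjoint T X :=
  [/\ B_H T, B_H X & forall x y, inner (A (T x)) y = inner (A x) (X y)].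

Lemma semi_adjointC T X : semi_adjoint T X -> semi_adjoint X T.
Proof.
case=> hT hX e; split=> // x y.
by rewrite (positive_inner _ _ hA) innerC -e innerC conjcK (positive_inner _ _ hA).
Qed.

Lemma sqrt_semi_bounded T X : semi_adjoint T X ->
  exists c : R, 0 <= c /\ forall x, rnorm (S (T x)) <= c * rnorm (S x).
Proof.
case=> hT hX e; have [c [c0 hc]] := semi_bounded hA hT hX e.
exists (Num.sqrt c); split=> [|x]; first exact: sqrtr_ge0.
rewrite -ler_sqr ?nnegrE ?mulr_ge0 ?sqrtr_ge0 ?rnorm_ge0 // exprMn sqr_sqrtr //.
by rewrite !rnorm_sqr -(positive_ripC (S (T x)) _ hS) -(positive_ripC (S x) _ hS)
  !sqrt_opK.
Qed.

Lemma tilde_exists T X : semi_adjoint T X ->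
  exists N : range_sqrt A -> range_sqrt A, bounded_op ip N /\
    forall u x, val u = A x -> val (N u) = A (T x).
Proof.
move=> TX; have [_ hX e] := TX; have lX := proj1 hX.
have [c [c0 hc]] := sqrt_semi_bounded (semi_adjointC TX).
(* The extension of [S x |-> S (T x)] to the closure of R(A) is the adjoint of
   the densely defined [S y |-> S (X y)]. *)
have /choice[E hE] : forall m, exists s, [/\ M s,
    forall y, inner (S (X y)) m = inner (S y) s & rnorm s <= c * rnorm m].
  move=> m; have [] := @riesz_range R H H S (fun y => inner (S (X y)) m) (c *
    rnorm m) lS.
  - by move=> a y z; rewrite lX lS innerDl innerZl.
  - by rewrite mulr_ge0 ?rnorm_ge0.
  - by move=> y; rewrite (le_trans (rip_le _ _)) // mulrAC ler_wpM2r ?rnorm_ge0.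
  by move=> s [/closure_range_sqrt cs h1 h2]; exists s.
have E_uniq m s : M s -> (forall y, inner (S (X y)) m = inner (S y) s) -> E m = s.
  move=> cs hs; have [cE hEm _] := hE m; apply: (closure_range_inj hA) => //.
  rewrite -!sqrt_opK; congr S; apply: inner_ext => y.
  by rewrite -!(positive_inner _ _ hS) -hEm hs.
have innerDr a x y z : inner z (a *: x + y) = a^* * inner z x + inner z y.
  by rewrite innerC innerDl innerZl rmorphD rmorphM /= -!innerC.
have lE : linear E.
  move=> a m n; have [cm hm _] := hE m; have [cn hn _] := hE n.
  apply: E_uniq => [|y]; first exact: closure_range_linear.
  by rewrite !innerDr hm hn.
exists (fun u => of_rep (E (rep u))).
have repE u : rep (of_rep (E (rep u))) = E (rep u) by apply: of_repK;
  case: (hE (rep u)).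
split.
  apply/bounded_range_sqrtP; split.
    by move=> a u v; apply: rep_inj; rewrite repE [RHS]rep_linear !repE rep_linear lE.
  by exists c; split=> // u; rewrite repE; case: (hE (rep u)).
move=> u x ux; rewrite -sqrt_opK /=; congr S; rewrite (rep_range ux).
apply: E_uniq; first exact: sqrt_op_closure.
move=> y; rewrite !(positive_inner _ _ hS) !sqrt_opK -!(positive_inner _ _ hA).
by have [_ _ ->] := semi_adjointC TX.
Qed.

Lemma tildeP T X : semi_adjoint T X -> bounded_op ip (tilde (A := A) T) /\
  forall u x, val u = A x -> val (tilde (A := A) T u) = A (T x).
Proof.
move=> TX; rewrite /tilde; case: xgetP => [N _ //|/= nN].
by have [N hN] := tilde_exists TX; case: (nN N).
Qed.

(** For both arguments in R(A) this is the relation between [T] and [X]; density extends it to the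
    first argument, then to the second. *)
Lemma tilde_adjoint T X u v : semi_adjoint T X ->
  ip (tilde (A := A) T u) v = ip u (tilde (A := A) X v).
Proof.
move=> TX; have [_ _ e] := TX.
have [/bounded_range_sqrtP[lT [c [c0 hc]]] hT] := tildeP TX.
have [/bounded_range_sqrtP[lX [d [d0 hd]]] hX] := tildeP (semi_adjointC TX).
set NT := tilde T in lT hc hT *; set NX := tilde X in lX hd hX *.
have repT x w : val w = A x -> rep (NT w) = S (T x) by move=> /hT /rep_range.
have repX x w : val w = A x -> rep (NX w) = S (X x) by move=> /hX /rep_range.
(* Real parts suffice, since [rep] and [NT] are complex linear. *)
suff h w z : rip (rep (NT w)) (rep z) = rip (rep w) (rep (NX z)).
  rewrite -[LHS]/(inner (rep (NT u)) (rep v)) -[RHS]/(inner (rep u) (rep (NX v))).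
  by rewrite !innerE h -!(linear_Z rep_linear) -(linear_Z lT) h.
have step1 x y w' z' : val w' = A x -> val z' = A y ->
    rip (rep (NT w')) (rep z') - rip (rep w') (rep (NX z')) = 0.
  move=> hw hz; rewrite (repT _ _ hw) (repX _ _ hz) (rep_range hw) (rep_range hz).
  by rewrite !(positive_ripC _ (S _) hS) !sqrt_opK -!(positive_ripC _ _ hA) /rip
    e subrr.
have step2 y z' w' : val z' = A y ->
    rip (rep (NT w')) (rep z') - rip (rep w') (rep (NX z')) = 0.
  move=> hz; have k0 : 0 <= c * rnorm (rep z') + rnorm (rep (NX z')).
    by rewrite addr_ge0 ?mulr_ge0 ?rnorm_ge0.
  move: w'; apply: (range_dense_eq0 (g := fun w =>
    rip (rep (NT w)) (rep z') - rip (rep w) (rep (NX z'))) k0) => [w1 w2|w1|w1 x hw].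
  - by rewrite (linear_B lT) !(linear_B rep_linear) !ripBl; ring.
  - rewrite (le_trans (ler_normB _ _)) // mulrDl lerD //.
      rewrite (le_trans (rip_abs_le _ _)) // mulrAC ler_wpM2r ?rnorm_ge0 //.
    by rewrite (le_trans (rip_abs_le _ _)) // mulrC.
  - exact: (step1 x y).
apply/eqP; rewrite -subr_eq0; apply/eqP.
have k0 : 0 <= rnorm (rep (NT w)) + d * rnorm (rep w).
  by rewrite addr_ge0 ?mulr_ge0 ?rnorm_ge0.
move: z; apply: (range_dense_eq0 (g := fun z =>
  rip (rep (NT w)) (rep z) - rip (rep w) (rep (NX z))) k0) => [z1 z2|z1|z1 y hz].
- by rewrite (linear_B lX) !(linear_B rep_linear) !ripBr; ring.
- rewrite (le_trans (ler_normB _ _)) // mulrDl lerD //.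
    exact: rip_abs_le.
  by rewrite (le_trans (rip_abs_le _ _)) // -mulrA mulrCA ler_wpM2l ?rnorm_ge0.
- exact: (step2 y).
Qed.

Lemma adjoint_tilde T X : semi_adjoint T X ->
  adjoint ip (tilde (A := A) T) = tilde (A := A) X.
Proof.
move=> TX; have [bX _] := tildeP (semi_adjointC TX).
rewrite /adjoint; case: xgetP => [N _ /= [bN hN]|/= nN]; last first.
  by case: (nN (tilde X)); split=> // x y; exact: tilde_adjoint.
apply/funext => v; apply: rep_inj; apply/eqP; rewrite -subr_eq0; apply/eqP/rip0_eq0.
set z := rep (N v) - rep (tilde X v).
have cz : M z.
  rewrite /z addrC -scaleN1r; apply: closure_range_linear => //.
    by case: (repP (tilde X v)).
  by case: (repP (N v)).
(* Uniqueness of the adjoint: the difference [z] is itself a representative, so both adjoint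
   relations can be tested on it. *)
rewrite -{1}(of_repK cz) ripBr; have := hN (of_rep z) v.
rewrite (tilde_adjoint _ _ TX) => /(congr1 (@complex.Re R)) h.
have {}h : rip (rep (of_rep z)) (rep (tilde X v)) =
  rip (rep (of_rep z)) (rep (N v)) := h.
by rewrite h subrr.
Qed.

(** The two products of [tilde T] and [tilde X] send [A x] to [A T X x] and [A X T x], and bounded
    operators agreeing on R(A) are equal. *)
Lemma normal_tilde T X : semi_adjoint T X ->
  normal_op ip (tilde (A := A) T) <-> forall x, A (X (T x)) = A (T (X x)).
Proof.
move=> TX; have [bT hT] := tildeP TX; have [bX hX] := tildeP (semi_adjointC TX).
rewrite /normal_op (adjoint_tilde TX); split=> [[_ e] x|e].
  have := congr1 (fun F => val (F (of_rep (S x)))) e => /=.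
  rewrite (hT _ (X x) (hX _ x (of_rep_range x))).
  by rewrite (hX _ (T x) (hT _ x (of_rep_range x))).
split=> //; apply: range_dense_agree; try exact: bounded_range_sqrt_comp.
move=> u x ux /=; apply: val_inj.
by rewrite (hT _ (X x) (hX _ x ux)) (hX _ (T x) (hT _ x ux)) e.
Qed.

End RangeSqrt.

(** * A-normality *)

Section Main.
Variables (R : realType) (H : hilbertType R) (A : H -> H) (hA : positive_op A).
Implicit Types (T X : H -> H).

Lemma semi_adjoint_sharp T : B_A A T -> semi_adjoint A T (sharp A T).
Proof.
move=> hT; have [bX e _] := sharpP hA hT; have [bT _] := hT.
split=> // x y; have := congr1 (fun F => F y) e => /= ey.
by rewrite (positive_inner x _ hA) ey -(proj2 (adjointP bT)) (positive_inner _ _ hA).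
Qed.

Lemma semi_normalP T : B_A A T ->
  semi_normal A T <-> forall x, A (sharp A T (T x)) = A (T (sharp A T x)).
Proof.
move=> hT; split=> [[_ e] x|e]; first exact: (congr1 (fun F => F x) e).
by split=> //; apply/funext => x /=; exact: e.
Qed.

(** Puts the range of [X^* A], for [X = sharp A T], inside R(A), so that [sharp] can be applied to
    [X]. *)
Lemma sharp_adjoint T x : B_A A T ->
  adjoint (inner : H -> H -> R[i]) (sharp A T) (A x) = A (T x).
Proof.
move=> hT; have [bT bX e] := semi_adjoint_sharp hT.
apply: inner_ext => z; rewrite -(proj2 (adjointP bX)) -!(positive_inner _ _ hA).
by have [_ _ ->] := semi_adjointC hA (semi_adjoint_sharp hT).
Qed.

Lemma B_A_sharp T : B_A A T -> B_A A (sharp A T).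
Proof.
move=> hT; split; first by have [] := semi_adjoint_sharp hT.
by move=> _ [x _ <-]; exists (T x) => //=; rewrite sharp_adjoint.
Qed.

Lemma A_sharp T x : B_A A T ->
  A (sharp A T x) = adjoint (inner : H -> H -> R[i]) T (A x).
Proof. by move=> hT; have [_ e _] := sharpP hA hT;
  exact: (congr1 (fun F => F x) e). Qed.

Lemma semi_normal_sharp T : B_A A T ->
  semi_normal A T <-> semi_normal A (sharp A T).
Proof.
move=> hT; have hX := B_A_sharp hT.
rewrite (semi_normalP hT) (semi_normalP hX).
have e x : A (sharp A (sharp A T) x) = A (T x) by rewrite A_sharp // sharp_adjoint.
(* As [A X = T^* A], only [A] times the inner vector matters, and [e] replaces it by [A (T x)]. *)
have e' x : A (sharp A T (sharp A (sharp A T) x)) = A (sharp A T (T x)).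
  by rewrite !(A_sharp _ hT) e.
by split=> h x; have := h x; rewrite e e' => ->.
Qed.

Lemma semi_normal_norm T : B_A A T ->
  semi_normal A T <->
  forall x, semi_norm A (T x) = semi_norm A (sharp A T x).
Proof.
move=> hT; rewrite (semi_normalP hT).
have TX := semi_adjoint_sharp hT; have [[lT _] [lX _] e] := TX.
have [_ _ e'] := semi_adjointC hA TX; have lA := positive_linear hA.
have qT x : inner (A (T x)) (T x) = inner (A (sharp A T (T x))) x.
  by rewrite e'.
have qX x : inner (A (sharp A T x)) (sharp A T x) = inner (A (T (sharp A T x))) x.
  by rewrite e.
split=> h x; first by rewrite /semi_norm /ipnorm /semi_inner qT qX h.
apply/eqP; rewrite -subr_eq0; apply/eqP; move: x.
apply: (@quad_form_eq0 R H (fun x => A (sharp A T (T x)) - A (T (sharp A T x)))).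
  by move=> a x y; rewrite !(lT, lX, lA) scalerBr opprD addrACA.
(* The quadratic form of the difference is [|T x|_A^2 - |X x|_A^2], which the hypothesis makes zero
   after squaring. *)
move=> x; rewrite innerBl -qT -qX.
by have := congr1 (fun z => z ^+ 2) (h x);
  rewrite /semi_norm /ipnorm /semi_inner !sqrtCK => ->; rewrite subrr.
Qed.

End Main.

Theorem theorem2p16 (R : realType) (H : hilbertType R)
    (hsep : separable H) (hinf : infinite_dimensional H)
    (A : H -> H) (hA : positive_op A) (hA0 : A <> (fun=> 0))
    (T : H -> H) (hT : B_A A T) :
  [/\ semi_normal A T <-> normal_op (range_sqrt_inner (A := A)) (tilde (A := A) T),
      semi_normal A T <-> semi_normal A (sharp A T)
    & semi_normal A T <->
      (forall x : H, semi_norm A (T x) = semi_norm A (sharp A T x))].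
Proof.
split; last exact: semi_normal_norm.
  by rewrite (semi_normalP hT) (normal_tilde hA (semi_adjoint_sharp hA hT)).
exact: semi_normal_sharp.
Qed.
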